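(* Let $n>1$ be an integer, let $V=\{v\in\{-1,1\}^n : v_1=1\}$, and for a real number $M$ let $K_M=\{(x_1,\dots,x_n)\in\mathbb{R}^n : x_i\le M \text{ for all } i\in[n]\}$. Consider the balancing game $G(V,K_M)$. Then: (1) If $n$ is odd, Chooser has a winning strategy if and only if $M\ge 2^{n-2}-\frac12\binom{n-1}{(n-1)/2}$. (2) If $n$ is even and not a power of $2$, Chooser has a winning strategy if and only if $M\ge 2^{n-2}-\frac12\binom{n-1}{n/2}$. (3) If $n$ is a power of $2$, Chooser has a winning strategy if and only if $M\ge 2^{n-2}-\frac12\binom{n-1}{n/2}+\frac12$. In each case the critical value of $M$ is $2^{n-2}(1-O(n^{-1/2}))$.
   Context: For a set $V\subset\mathbb{R}^n$ and a convex set $K\subseteq\mathbb{R}^n$, the balancing game $G(V,K)$ is a perfect-information game between Pusher and Chooser producing a sequence of points $z_0=0,z_1,z_2,\dots\in\mathbb{R}^n$: in round $k$, Pusher offers a vector $v_k\in V$, Chooser selects $\varepsilon_k\in\{-1,1\}$, and the next position is $z_{k+1}=z_k+\varepsilon_k v_k$. Pusher wins if at some point $z_k\notin K$; Chooser wins if she can keep $z_k\in K$ for all $k$. *)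

(* Defs.v *)
From HB Require Import structures.
From mathcomp Require Import all_boot all_order all_algebra.
From mathcomp Require Import boolp classical_sets reals.
Set Implicit Arguments. Unset Strict Implicit. Unset Printing Implicit Defensive.
Import Order.TTheory GRing.Theory Num.Theory.
Local Open Scope ring_scope.
Local Open Scope classical_set_scope.

Section Game.
Variables (R : realType) (n : nat).

Definition sgn_of (b : bool) : R := if b then 1 else -1.

(* A Chooser strategy: given the list of vectors offered so far
   [v_0; ...; v_k] (the last one being the current offer), it returns eps_k.
   Since Chooser's own previous moves are determined by her strategy and the
   previous offers, this is the full information available to her. *)
Definition chooser_strategy := seq 'rV[R]_n -> bool.

Definition position (s : chooser_strategy) (v : nat -> 'rV[R]_n) (k : nat)
  : 'rV[R]_n :=
  \sum_(j < k) sgn_of (s (mkseq v j.+1)) *: v j.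

(* Chooser has a winning strategy in G(V,K): some strategy keeps every
   position z_k (k >= 0) inside K against every sequence of offers from V.
   (Against a fixed deterministic Chooser strategy, any adaptive Pusher
   strategy produces one such sequence, so quantifying over sequences is the
   same as quantifying over Pusher strategies.) *)
Definition chooser_wins (V K : set 'rV[R]_n) : Prop :=
  exists s : chooser_strategy,
    forall v : nat -> 'rV[R]_n, (forall k, V (v k)) ->
      forall k, K (position s v k).

Definition Vpm : set 'rV[R]_n :=
  [set v | (forall i : 'I_n, v 0 i = 1 \/ v 0 i = -1) /\
           (forall i : 'I_n, val i = 0%N -> v 0 i = 1)].

Definition KM (M : R) : set 'rV[R]_n := [set x | forall i : 'I_n, x 0 i <= M].

End Game.

Definition is_pow2 (n : nat) : Prop := exists k : nat, n = (2 ^ k)%N.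

Definition crit_val (R : realType) (n : nat) : R :=
  if odd n then 2 ^+ (n - 2) - ('C(n.-1, n.-1./2))%:R / 2
  else if `[< is_pow2 n >] then 2 ^+ (n - 2) - ('C(n.-1, n./2))%:R / 2 + 1 / 2
  else 2 ^+ (n - 2) - ('C(n.-1, n./2))%:R / 2.

(* Main.v *)
Require Import Defs.
From HB Require Import structures.
From mathcomp Require Import all_boot all_order all_algebra.
From mathcomp Require Import boolp classical_sets reals.
From mathcomp Require Import perm zify ring lra.
Set Implicit Arguments. Unset Strict Implicit. Unset Printing Implicit Defensive.
Import Order.TTheory GRing.Theory Num.Theory.
Local Open Scope ring_scope.

(** Offering a vector amounts to offering a pair {A, ~: A} of subsets of [n]:
    Chooser adds +1 on one of them and -1 on the other.  The sum of
    min(|A|, n - |A|) over all pairs is n * gap n / 2, and the critical value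
    is gap n / 2 rounded up to an integer.

    Chooser fixes a member of minimal size of each pair, plays it the first
    time the pair is offered, and alternates afterwards; coordinate i never
    exceeds the number of selected sets containing i.  For even n the
    selection among the sets of size n/2 has to be balanced: if i has larger
    degree than j, exchanging i and j yields two selected sets whose
    replacement by their complements moves two units from i to j.  All degrees
    have the same parity, which replacing one set of size n/2 by its complement
    changes, so minimising the sum of squares in the right parity class brings
    every degree down to the rounded average.

    Conversely, let W be the set of positions reachable against a winning
    strategy, lin a generic functional close to the sum of coordinates, and z
    maximise lin on W.  Along the functionals lin + t x_i, t >= 0, every sign
    vector A containing i with lin A < 0 becomes orthogonal to the functional
    at a time of its own, and then the face of maximal positions is closed
    under a step by A or by -A; so the i-th coordinate of the maximal positions
    grows by at least one.  Hence W contains a position with i-th coordinate at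
    least z_i + #{A containing i | lin A < 0}.  Summing over i, and using that
    the coordinates of z have nonnegative sum, gives n M >= n * gap n / 2. *)

(** * Binomial coefficients *)

Definition gap (n : nat) : nat := (2 ^ n.-1 - 'C(n.-1, n./2))%N.

(** In Pascal's rule applied twice the middle term occurs twice, hence cancels modulo 2. *)
Lemma odd_binS2 n k :
  odd 'C(n.+2, k.+2) = odd 'C(n, k) (+) odd 'C(n, k.+2).
Proof.
rewrite !binS !oddD.
by case: (odd 'C(n, k.+2)); case: (odd 'C(n, k.+1)); case: (odd 'C(n, k)).
Qed.

(** One digit of Lucas's theorem modulo 2: the last binary digit of [a.*2.+1] is 1, so the last
    digit of [k] has no influence. *)
Lemma odd_bin_double a k : odd 'C(a.*2.+1, k) = odd 'C(a, k./2).
Proof.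
elim: a k => [|a IH] [|[|k]] //=.
- by rewrite bin1 /= odd_double.
- by rewrite odd_binS2 IH IH -oddD addnC -binS.
Qed.

Lemma odd_central_bin m : odd 'C(m.*2, m) = (m == 0)%N.
Proof.
case: m => [|m] //.
have -> : m.+1.*2 = m.*2.+2 by rewrite doubleS.
rewrite binS -[X in (_ + X)%N]bin_sub; last by lia.
by rewrite (_ : m.*2.+1 - m = m.+1)%N ?addnn ?odd_double //; lia.
Qed.

(** By [odd_bin_double] the parity is that of ['C(m.-1, m./2)]. For odd [m] this is a central
    coefficient, odd only for [m = 1]; for even [m] it is the same question for [m./2]. *)
Lemma odd_bin_pow2 m : (0 < m)%N ->
  odd 'C(m.*2.-1, m) <-> is_pow2 m.*2.
Proof.
elim/ltn_ind: m => m IH m0.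
have -> : m.*2.-1 = m.-1.*2.+1 by lia.
rewrite odd_bin_double.
case: (boolP (odd m)) => om.
  have -> : m.-1 = m./2.*2 by lia.
  rewrite odd_central_bin; split=> [/eqP h|[k mk]].
    by exists 1%N; lia.
  case: k mk => [|k] mk; first by lia.
  have {}mk : m = (2 ^ k)%N by rewrite expnS in mk; lia.
  by case: k mk => [|k] mk; [lia | rewrite expnS in mk; lia].
have em : m = m./2.*2 by lia.
rewrite [X in 'C(X.-1, _)]em.
rewrite IH; [|lia|lia].
rewrite -em; split=> [[k mk]|[k mk]].
  by exists k.+1; rewrite expnS -mk; lia.
case: k mk => [|k] mk; first by lia.
by exists k; rewrite expnS in mk; lia.
Qed.

Lemma odd_bin_half n : (1 < n)%N -> odd 'C(n.-1, n./2) <-> is_pow2 n.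
Proof.
move=> n1; case: (boolP (odd n)) => on.
  have -> : n.-1 = n./2.*2 by lia.
  rewrite odd_central_bin; split; first by lia.
  by case=> -[|k] nk; [lia | rewrite expnS in nk; lia].
have nE : n = n./2.*2 by lia.
by have := @odd_bin_pow2 n./2; rewrite -nE; apply; lia.
Qed.

(** Induction through the ratio of consecutive central coefficients, using (2m+1)(2m+3) <= 4(m+1)^2.
    The order n^(-1/2) of the error term comes from here. *)
Lemma sqr_central_bin m : ((m.*2.+1) * 'C(m.*2, m) ^ 2 <= 16 ^ m)%N.
Proof.
elim: m => [|m IH] //.
have h : ('C(m.+1.*2, m.+1) * m.+1 = 2 * (m.*2.+1 * 'C(m.*2, m)))%N.
  have -> : m.+1.*2 = m.*2.+2 by lia.
  have h6 : 'C(m.*2.+1, m.+1) = 'C(m.*2.+1, m).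
    rewrite -bin_sub; last by lia.
    by congr 'C(_, _); lia.
  rewrite binS h6 addnn -mul2n -mulnA; congr (2 * _)%N.
  rewrite -[in RHS]/(m.*2.+1.-1) mul_bin_down /=.
  by rewrite mulnC; congr (_ * _)%N; lia.
have p : (0 < m.+1 ^ 2)%N by rewrite expn_gt0.
rewrite -(leq_pmul2r p) -mulnA -expnMn h.
have -> : (m.+1.*2.+1 * (2 * (m.*2.+1 * 'C(m.*2, m))) ^ 2 =
   (4 * m.+1.*2.+1 * m.*2.+1) * (m.*2.+1 * 'C(m.*2, m) ^ 2))%N by ring.
rewrite (expnS 16) (_ : 16 * 16 ^ m * m.+1 ^ 2 = (16 * m.+1 ^ 2) * 16 ^ m)%N; last by ring.
by apply: leq_mul => //; nia.
Qed.

Lemma sqr_bin_half n : (0 < n)%N -> (n * 'C(n.-1, n./2) ^ 2 <= 4 ^ n.-1)%N.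
Proof.
move=> n0; case: (boolP (odd n)) => on.
  have -> : n.-1 = n./2.*2 by lia.
  have h := sqr_central_bin n./2.
  have -> : (4 ^ n./2.*2 = 16 ^ n./2)%N by rewrite -mul2n expnM.
  by rewrite {1}(_ : n = n./2.*2.+1) //; lia.
have [m nE] : exists m, n = m.+1.*2 by exists n./2.-1; lia.
have h := sqr_central_bin m.+1.
have h6 : 'C(m.+1.*2, m.+1) = (2 * 'C(m.*2.+1, m.+1))%N.
  rewrite doubleS binS (_ : 'C(m.*2.+1, m) = 'C(m.*2.+1, m.+1)); first by lia.
  by rewrite -bin_sub; [congr 'C(_, _); lia | lia].
rewrite nE (_ : m.+1.*2./2 = m.+1); last by lia.
have -> : m.+1.*2.-1 = m.*2.+1 by lia.
rewrite h6 in h.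
have e : (16 ^ m.+1 = 4 * 4 ^ (m.*2.+1))%N.
  by rewrite -expnS (_ : m.*2.+2 = 2 * m.+1)%N ?expnM //; lia.
rewrite e in h; move: h.
by move: (4 ^ _)%N ('C(_, _)) => x y; nia.
Qed.

Lemma sum_bin m : (\sum_(k < m.+2) 'C(m, k) = 2 ^ m)%N.
Proof.
rewrite big_ord_recr /= bin_small // addn0 -[2%N]/(1 + 1)%N expnDn.
by apply: eq_bigr => i _; rewrite !exp1n !muln1.
Qed.

Lemma sum_shift_below (f : nat -> nat) h N : (h <= N)%N ->
  (\sum_(k < N.+1) (if k <= h then (if k == 0 :> nat then 0 else f k.-1) else f k)
    + f h = \sum_(k < N.+1) f k)%N.
Proof.
move=> /subnK <-; elim: (N - h)%N => [|d IH].
  rewrite add0n big_ord_recl /= add0n [RHS]big_ord_recr /=; congr (_ + _)%N.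
  by apply: eq_bigr => i _; rewrite /bump /= add1n ltn_ord.
rewrite addSn big_ord_recr [RHS]big_ord_recr /= -IH.
by rewrite leqNgt ltnS leq_addl /= addnAC.
Qed.

(** Absorption turns k C(n,k) into n C(n-1,k-1) and (n-k) C(n,k) into n C(n-1,k). Passing from the
    first form to the second after k = n/2 omits exactly C(n-1,n/2) from the full row. *)
Lemma sum_bin_min n : (0 < n)%N ->
  (\sum_(k < n.+1) 'C(n, k) * minn k (n - k) = n * gap n)%N.
Proof.
case: n => [|n] // _; rewrite /gap.
have hn : (n.+1./2 <= n.+1)%N by lia.
have <- : (\sum_(k < n.+2) (if k <= n.+1./2 then
    (if k == 0 :> nat then 0 else 'C(n, k.-1)) else 'C(n, k)) =
    2 ^ n - 'C(n, n.+1./2))%N.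
  by rewrite -sum_bin -(sum_shift_below _ hn) addnK.
rewrite big_distrr /=; apply: eq_bigr => -[k kn] _ /=.
case: leqP => kh.
  rewrite (minn_idPl _); last by lia.
  case: k kn kh => [|k] kn kh; first by rewrite !muln0.
  by rewrite /= mulnC mul_bin_diag.
rewrite (minn_idPr _); last by lia.
by rewrite mulnC -mul_bin_down.
Qed.

Lemma sum_set_card n (g : nat -> nat) :
  (\sum_(A : {set 'I_n}) g #|A| = \sum_(k < n.+1) 'C(n, k) * g k)%N.
Proof.
have hc (A : {set 'I_n}) : (#|A| < n.+1)%N.
  by rewrite ltnS -[X in (_ <= X)%N]card_ord max_card.
rewrite (partition_big (fun A : {set 'I_n} => Ordinal (hc A)) predT) //=.
apply: eq_bigr => k _.
rewrite (eq_bigr (fun=> g k)); last by move=> A /eqP <-.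
rewrite sum_nat_const; congr (_ * _)%N.
rewrite -[X in 'C(X, _)](card_ord n) -card_draws.
by rewrite cardsE.
Qed.

(** * Balanced selections of one set from each complementary pair *)

Section Families.
Variable n : nat.
Implicit Types (A B : {set 'I_n}) (F : {set {set 'I_n}}) (i j k : 'I_n).

Definition selector F := [forall A, (A \in F) (+) (~: A \in F)].

Definition minority F := [forall A in F, #|A|.*2 <= n]%N.

Definition degree F i : nat := #|[set A in F | i \in A]|.

Definition flip F A := ~: A |: (F :\ A).

Lemma selectorC F A : selector F -> (~: A \in F) = (A \notin F).
Proof. by move=> /forallP/(_ A); case: (A \in F); case: (~: A \in F). Qed.

Lemma degreeE F i : degree F i = (\sum_(A in F) (i \in A))%N.
Proof.
rewrite /degree -sum1_card big_mkcond [RHS]big_mkcond /=.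
by apply: eq_bigr => A _; rewrite inE; case: (A \in F); case: (i \in A).
Qed.

Lemma sum_degree F : (\sum_i degree F i = \sum_(A in F) #|A|)%N.
Proof.
under eq_bigr do rewrite degreeE.
rewrite exchange_big /=; apply: eq_bigr => A _.
by rewrite -sum1_card [RHS]big_mkcond; apply: eq_bigr => i _; case: (i \in A).
Qed.

Lemma sum_selector F (g : {set 'I_n} -> nat) : selector F ->
  (forall A, g (~: A) = g A) -> (\sum_A g A = 2 * \sum_(A in F) g A)%N.
Proof.
move=> sF gC; rewrite (bigID (mem F)) /= mul2n -addnn; congr (_ + _)%N.
rewrite (reindex_inj (@finset.setC_inj _)) /=.
by apply: eq_big => [A|A _]; rewrite ?gC // selectorC // negbK.
Qed.

Lemma card_setC A : #|~: A| = (n - #|A|)%N.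
Proof. by rewrite cardsCs finset.setCK card_ord. Qed.

Lemma card_tperm_imset i j A : #|tperm i j @: A| = #|A|.
Proof. by apply: card_imset; apply: perm_inj. Qed.

Lemma sum_selector_min F : (0 < n)%N -> selector F ->
  (2 * \sum_(A in F) minn #|A| (n - #|A|) = n * gap n)%N.
Proof.
move=> n0 sF; rewrite -sum_bin_min // -(@sum_set_card n (fun x : nat => minn x (n - x))).
rewrite -(@sum_selector F (fun A => minn #|A| (n - #|A|))) // => A.
have := cardsC A; rewrite card_ord => h.
by rewrite minnC; congr minn; lia.
Qed.

Lemma sum_degree_minority F : (0 < n)%N -> selector F -> minority F ->
  (2 * \sum_i degree F i = n * gap n)%N.
Proof.
move=> n0 sF /forall_inP mF; rewrite sum_degree -(sum_selector_min n0 sF).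
congr (2 * _)%N; apply: eq_bigr => A /mF h.
by rewrite (minn_idPl _) //; lia.
Qed.

Lemma setC_neq A : (0 < n)%N -> ~: A != A.
Proof.
move=> n0; apply/eqP => /setP/(_ (Ordinal n0)); rewrite inE.
by case: (_ \in A).
Qed.

Lemma degree_flip F A i : (0 < n)%N -> selector F -> A \in F ->
  (degree (flip F A) i + (i \in A) = degree F i + (i \notin A))%N.
Proof.
move=> n0 sF AF; rewrite !degreeE /flip.
rewrite (big_setU1 (~: A)) /=; last first.
  by rewrite !inE selectorC // AF andbF.
by rewrite [in RHS](big_setD1 A) //= finset.in_setC [LHS]addnC addnA [RHS]addnAC.
Qed.

Lemma selector_flip F A : selector F -> selector (flip F A).
Proof.
move=> sF; apply/forallP => B; rewrite /flip !inE (selectorC B sF).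
rewrite (can_eq (@finset.setCK _)) (can2_eq (@finset.setCK _) (@finset.setCK _)).
have [->|BA] := eqVneq B A.
  have [E|//] := eqVneq A (~: A).
    by move: sF => /forallP/(_ A); rewrite -E; case: (A \in F).
have [->|BA'] := eqVneq B (~: A); first by [].
by rewrite /=; case: (B \in F).
Qed.

Lemma minority_flip F A : minority F -> #|A|.*2 = n -> minority (flip F A).
Proof.
move=> /forall_inP mF hA; apply/forall_inP => B; rewrite !inE.
case/orP=> [/eqP ->|/andP[_ /mF] //].
by have := cardsC A; rewrite card_ord; lia.
Qed.

(* Otherwise the transposition (i j) maps the members containing i injectively
   to members containing j. *)
Lemma degree_lt_separating F i j : selector F -> minority F ->
  (degree F j < degree F i)%N ->
  exists A, [/\ A \in F, i \in A, j \notin A, #|A|.*2 = n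
              & ~: (tperm i j @: A) \in F].
Proof.
move=> sF /forall_inP mF; rewrite ltnNge => h.
have /existsP[A /and4P[AF iA jA A'F]] : [exists A, [&& A \in F, i \in A,
    j \notin A & tperm i j @: A \notin F]].
  apply: contraNT h => /existsPn h.
  have pinj : injective (fun A => tperm i j @: A).
    by apply: imset_inj; apply: perm_inj.
  rewrite /degree -(card_imset _ pinj); apply: subset_leq_card.
  apply/fintype.subsetP => A' /imsetP[A]; rewrite inE => /andP[AF iA] ->.
  have jA' : j \in tperm i j @: A by apply/imsetP; exists i; rewrite ?tpermL.
  rewrite inE jA' andbT.
  have := h A; rewrite AF iA /= negb_and negbK negbK => /orP[jA|//].
  suff -> : tperm i j @: A = A by [].
  apply/eqP; rewrite eqEcard card_imset ?leqnn ?andbT; last exact: perm_inj.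
  by apply/fintype.subsetP => y /imsetP[x xA ->]; case: tpermP => // ->.
have A'F' : ~: (tperm i j @: A) \in F by rewrite selectorC.
exists A; split=> //.
have h1 := mF _ AF; have h2 := mF _ A'F'.
by move: h2; rewrite card_setC card_tperm_imset; lia.
Qed.

Lemma mem_tperm_imset i j A x : (x \in tperm i j @: A) = (tperm i j x \in A).
Proof.
apply/imsetP/idP => [[y yA ->]|h]; first by rewrite tpermK.
by exists (tperm i j x); rewrite ?tpermK.
Qed.

(** The sets [A] and [C] both contain [i] and not [j], and are complementary elsewhere, so flipping
    both leaves the other degrees unchanged. *)
Lemma transfer_degree F i j : (2 < n)%N -> selector F -> minority F ->
  (degree F j < degree F i)%N ->
  exists F', [/\ selector F', minority F', degree F' i + 2 = degree F i,
     degree F' j = degree F j + 2 &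
     forall k, k != i -> k != j -> degree F' k = degree F k]%N.
Proof.
move=> n2 sF mF dij.
have [A [AF iA jA hA A'F]] := degree_lt_separating sF mF dij.
have n0 : (0 < n)%N by lia.
set C := ~: (tperm i j @: A) in A'F.
have hC : #|C|.*2 = n.
  by rewrite card_setC card_tperm_imset; lia.
have iC : i \in C by rewrite inE mem_tperm_imset tpermL.
have jC : j \notin C by rewrite inE mem_tperm_imset tpermR iA.
have kC k : k != i -> k != j -> (k \in C) = (k \notin A).
  by move=> ki kj; rewrite inE mem_tperm_imset tpermD // eq_sym.
(* Any third index lies in exactly one of [A] and [C]; this is where [2 < n] enters. *)
have CA : C != A.
  apply/eqP => E.
  have /subset_leq_card : [set: 'I_n] \subset [set i; j].
    apply/fintype.subsetP => k _; rewrite !inE.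
    have [//|ki] := eqVneq k i; have [//|kj] := eqVneq k j.
    by have := kC k ki kj; rewrite E; case: (k \in A).
  by rewrite cardsT card_ord cards2; case: (i != j) => /=; lia.
have CF : C \in flip F A by rewrite !inE CA A'F orbT.
have sF1 := selector_flip A sF.
exists (flip (flip F A) C); split.
- exact: selector_flip.
- by apply: minority_flip => //; apply: minority_flip.
- have := degree_flip i n0 sF1 CF; have := degree_flip i n0 sF AF.
  by rewrite iA iC /=; move: (degree _ i) (degree _ i) (degree _ i) => ? ? ?; clear; lia.
- have := degree_flip j n0 sF1 CF; have := degree_flip j n0 sF AF.
  by rewrite (negbTE jA) (negbTE jC) /=; move: (degree _ j) (degree _ j) (degree _ j) => ? ? ?; clear; lia.
- move=> k ki kj.
  have := degree_flip k n0 sF1 CF; have := degree_flip k n0 sF AF.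
  by rewrite kC //; case: (k \in A) => /=; move: (degree _ k) (degree _ k) (degree _ k) => ? ? ?; clear; lia.
Qed.

Lemma card_separating i j : i != j ->
  #|[set A : {set 'I_n} | (i \in A) && (j \notin A)]| = (2 ^ (n - 2))%N.
Proof.
move=> ij.
have <- : #|powerset (~: [set i; j])| = (2 ^ (n - 2))%N.
  rewrite card_powerset; congr (2 ^ _)%N.
  by have := cardsC [set i; j]; rewrite cards2 ij card_ord /=; lia.
have inj : {in powerset (~: [set i; j]) &, injective (fun B => i |: B)}.
  move=> A B; rewrite !inE => hA hB E.
  have h (X : {set 'I_n}) : X \subset ~: [set i; j] -> (i |: X) :\ i = X.
    move=> hX; apply: setU1K; apply/negP => /(fintype.subsetP hX).
    by rewrite !inE eqxx.
  by rewrite -(h A hA) E h.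
rewrite -(card_in_imset inj); apply: eq_card => A; rewrite inE.
apply/andP/imsetP => [[iA jA]|[B]].
  exists (A :\ i); last by rewrite finset.setD1K.
  rewrite inE; apply/fintype.subsetP => x; rewrite !inE => /andP[xi xA].
  by rewrite (negbTE xi) /=; apply: contraNneq jA => <-.
rewrite inE => hB ->; rewrite !inE eqxx /= negb_or eq_sym ij; split=> //.
by apply/negP => /(fintype.subsetP hB); rewrite !inE eqxx orbT.
Qed.

(** The sum of the two degrees has the parity of the number of selected sets separating [i] from
    [j]. Complementation preserves separation, so half of the [2 * 2 ^ (n - 2)] separating sets are
    selected, an even number. *)
Lemma odd_degree F i j : (2 < n)%N -> selector F ->
  odd (degree F i) = odd (degree F j).
Proof.
move=> n2 sF; have [->//|ij] := eqVneq i j.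
have e : (degree F i + degree F j =
   2 * (\sum_(A in F) ((i \in A) && (j \in A)))
   + \sum_(A in F) ((i \in A) (+) (j \in A)))%N.
  rewrite !degreeE big_distrr /= -!big_split /=; apply: eq_bigr => A _.
  by case: (i \in A); case: (j \in A).
have g : (2 * \sum_(A in F) ((i \in A) (+) (j \in A)) = 2 * 2 ^ (n - 2))%N.
  rewrite -(@sum_selector F (fun A => (i \in A) (+) (j \in A) : nat)) //; last first.
    by move=> A; rewrite !inE; case: (i \in A); case: (j \in A).
  rewrite mul2n -addnn -{1}(card_separating ij).
  rewrite -(@card_separating j i) 1?eq_sym // -!sum1_card.
  rewrite [in RHS]big_mkcond [X in (_ + X)%N]big_mkcond /= -big_split /=.
  by apply: eq_bigr => A _; rewrite !inE; case: (i \in A); case: (j \in A).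
have {}g : (\sum_(A in F) ((i \in A) (+) (j \in A)) = 2 ^ (n - 2))%N by lia.
have h : odd (2 ^ (n - 2)) = false by rewrite oddX /=; lia.
have : odd (degree F i + degree F j) = false.
  by rewrite e g oddD h mul2n odd_double.
by rewrite oddD; case: (odd _); case: (odd _).
Qed.

Lemma minority_selector_exists : (0 < n)%N ->
  exists F, selector F && minority F.
Proof.
move=> n0; pose o := Ordinal n0.
(* Only pairs of sets of size n/2 leave a choice, which membership of [o] settles. *)
exists [set A : {set 'I_n} | (#|A|.*2 < n) || (#|A|.*2 == n) && (o \in A)]%N.
apply/andP; split; last first.
  by apply/forall_inP => A; rewrite inE => /orP[/ltnW //|/andP[/eqP ->]].
apply/forallP => A; rewrite !inE.
have := cardsC A; rewrite card_ord => h.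
have -> : (#|~: A|.*2 < n)%N = (n < #|A|.*2)%N by lia.
have -> : (#|~: A|.*2 == n)%N = (#|A|.*2 == n)%N by lia.
by case: ltngtP; case: (o \in A).
Qed.

Lemma balanced_exists : ~~ odd n -> exists A : {set 'I_n}, #|A|.*2 = n.
Proof.
move=> en.
have : (0 < #|[set A : {set 'I_n} | #|A| == n./2]|)%N.
  by rewrite card_draws card_ord bin_gt0; lia.
by case/card_gt0P => A; rewrite inE => /eqP hA; exists A; lia.
Qed.

Lemma selector_parity_exists b i : (2 < n)%N -> ~~ odd n ->
  exists F, [&& selector F, minority F & odd (degree F i) == b].
Proof.
move=> n2 en; have n0 : (0 < n)%N by lia.
have [F /andP[sF mF]] := minority_selector_exists n0.
have [E|E] := eqVneq (odd (degree F i)) b.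
  by exists F; rewrite sF mF E eqxx.
have [A0 hA0] := balanced_exists en.
have [A AF hA] : exists2 A, A \in F & #|A|.*2 = n.
  have := cardsC A0; rewrite card_ord => hC.
  have [h|h] := boolP (A0 \in F); first by exists A0.
  by exists (~: A0); [rewrite selectorC | lia].
exists (flip F A); rewrite selector_flip // minority_flip //=.
have := degree_flip i n0 sF AF => /(congr1 odd); rewrite !oddD.
by case: (i \in A) => /=; move: E; case: (odd _); case: (odd _); case: b.
Qed.

Lemma balanced_selector_exists : (1 < n)%N ->
  exists F, selector F /\ forall i, (degree F i <= uphalf (gap n))%N.
Proof.
move=> n1; have n0 : (0 < n)%N by lia.
have [n2|n2] : (2 < n)%N \/ n = 2 by lia.
- have [on|en] := boolP (odd n).
    have [F /andP[sF mF]] := minority_selector_exists n0.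
    exists F; split=> // i.
    (* Unequal degrees would produce a set of size n/2, impossible for odd [n]. *)
    have dd j k : (degree F j <= degree F k)%N.
      rewrite leqNgt; apply/negP => /(degree_lt_separating sF mF)[A [_ _ _ h _]].
      by lia.
    have := sum_degree_minority n0 sF mF.
    rewrite (eq_bigr (fun=> degree F i)); last first.
      by move=> j _; apply/eqP; rewrite eqn_leq !dd.
    rewrite sum_nat_const card_ord mulnCA => /eqP.
    by rewrite eqn_pmul2l // => /eqP; lia.
  pose o := Ordinal n0.
  pose P F := [&& selector F, minority F & odd (degree F o) == odd (uphalf (gap n))].
  have [F0 PF0] : exists F, P F := selector_parity_exists _ _ n2 en.
  case: (arg_minnP (fun F => \sum_i degree F i ^ 2)%N PF0) => F /and3P[sF mF oF] minF.
  exists F; split=> // i; rewrite leqNgt; apply/negP => hi.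
  (* Equal parity turns an excess of one into an excess of two. *)
  have hi2 : (uphalf (gap n) + 2 <= degree F i)%N.
    have := odd_degree i o n2 sF; rewrite (eqP oF); lia.
  (* Otherwise the degrees of [i] and [j] differ by at least 3, and moving two units from [i] to [j]
     lowers the sum of squares by four times the difference less two. *)
  have dj j : (uphalf (gap n) <= degree F j)%N.
    rewrite leqNgt; apply/negP => hj.
    have ij : i != j by apply/eqP => E; rewrite -E in hj; lia.
    have dij : (degree F j < degree F i)%N by lia.
    have [F' [sF' mF' di' dj' dk']] := transfer_degree n2 sF mF dij.
    have PF' : P F'.
      rewrite /P sF' mF' /= -(eqP oF) (odd_degree o i n2 sF') (odd_degree o i n2 sF).
      by apply/eqP; rewrite -di' oddD addbF.
    have := minF _ PF'.
    rewrite (bigD1 i) //= (bigD1 j) ?(eq_sym j) //=.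
    rewrite [X in (_ <= X)%N](bigD1 i) //= [X in (_ <= _ + X)%N](bigD1 j) ?(eq_sym j) //=.
    have -> : (\sum_(k < n | (k != i) && (k != j)) degree F' k ^ 2 =
      \sum_(k < n | (k != i) && (k != j)) degree F k ^ 2)%N.
      by apply: eq_bigr => k /andP[ki kj]; rewrite dk'.
    move: hi2 hj; rewrite dj' -di' => {}hi2 {}hj.
    by rewrite !addnA leq_add2r; clear -hi2 hj; nia.
  (* No degree is below the rounded average and that of [i] is above it, against the known total. *)
  have := sum_degree_minority n0 sF mF.
  rewrite (bigD1 i) //=; set S := bigop.body _ _ _ => sumE.
  have : (\sum_(j < n | j != i) uphalf (gap n) <= S)%N by apply: leq_sum.
  rewrite sum_nat_const.
  have -> : #|(fun j => j != i)| = n.-1.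
    by have := cardC1 i; rewrite card_ord => <-; apply: eq_card => x; rewrite !inE.
  move: S sumE hi2; move: (degree F i) => d S sumE hi2 hS.
  have h : (n * gap n <= n * (2 * uphalf (gap n)))%N by rewrite leq_mul2l; lia.
  have E : (n * (2 * uphalf (gap n)) = 2 * (uphalf (gap n) + n.-1 * uphalf (gap n)))%N.
    by rewrite -mulSn prednK // mulnCA.
  by lia.
(* The case [n = 2]: the only set of size at most one containing [i] is [[set i]]. *)
have [F /andP[sF mF]] := minority_selector_exists n0.
exists F; split=> // i.
have -> : uphalf (gap n) = 1%N by rewrite n2.
rewrite /degree -(cards1 [set i]); apply: subset_leq_card.
apply/fintype.subsetP => A; rewrite !inE => /andP[AF iA].
have := (forall_inP mF) _ AF => h.
by rewrite eq_sym eqEcard finset.sub1set iA cards1; lia.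
Qed.

End Families.

(** * The lower bound *)

Lemma int_max_exists (T : Type) (W : T -> Prop) (f : T -> int) (b : int) z0 :
  W z0 -> (forall z, W z -> f z <= b) ->
  exists2 z, W z & forall y, W y -> f y <= f z.
Proof.
move=> Wz0 fb; move: {2}(absz (b - f z0)) (leqnn (absz (b - f z0))) => m.
elim: m z0 Wz0 => [|m IH] z Wz hm.
  by exists z => // y Wy; have := fb y Wy; have := fb z Wz; lia.
have [h|h] := pselect (exists2 y, W y & f z < f y).
  have [y Wy zy] := h; apply: (IH y Wy).
  by have := fb y Wy; have := fb z Wz; lia.
exists z => // y Wy; rewrite leNgt; apply/negP => zy.
by apply: h; exists y.
Qed.

Lemma binary_inj n (a b : nat -> bool) :
  (\sum_(i < n) a i * 2 ^ i = \sum_(i < n) b i * 2 ^ i)%N ->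
  forall i, (i < n)%N -> a i = b i.
Proof.
elim: n a b => [|n IH] a b //; rewrite !big_ord_recl /= !muln1.
have E (c : nat -> bool) : (\sum_(i < n) c (bump 0 i) * 2 ^ bump 0 i =
    2 * \sum_(i < n) c i.+1 * 2 ^ i)%N.
  rewrite big_distrr /=; apply: eq_bigr => i _.
  by rewrite /bump /= add1n expnS mulnCA.
rewrite !E => h [|i] hi.
  by move: h; case: (a 0%N); case: (b 0%N) => /=; lia.
have h0 : a 0%N = b 0%N by move: h; case: (a 0%N); case: (b 0%N) => /=; lia.
by apply: (IH (fun i => a i.+1) (fun i => b i.+1)) => //; move: h; rewrite h0; lia.
Qed.

Lemma sum_expn2 n : (\sum_(i < n) 2 ^ i = 2 ^ n - 1)%N.
Proof.
elim: n => [|n IH]; first by rewrite big_ord0.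
by rewrite big_ord_recr /= IH expnS; have := expn_gt0 2 n; lia.
Qed.

Section Pusher.
Variables (n : nat) (W : ('I_n -> int) -> Prop) (m : nat).
Implicit Types (A B : {set 'I_n}) (i j : 'I_n) (y z : 'I_n -> int).

Definition sgset A i : int := if i \in A then 1 else -1.

Hypothesis n_gt0 : (0 < n)%N.
Hypothesis W0 : W (fun=> 0).
(** Complementing [A] exchanges the two alternatives, so [A] may be arbitrary although the game
    fixes the first sign. *)
Hypothesis W_step : forall z A, W z ->
  W (fun i => z i + sgset A i) \/ W (fun i => z i - sgset A i).
Hypothesis W_le : forall z i, W z -> z i <= m%:Z.

(* A small perturbation of the all-ones functional (up to scaling) that takes
   distinct values on distinct sign vectors. *)
Definition weight i : nat := (m.+1 * 2 ^ n + 2 ^ i)%N.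

Definition lin z : int := \sum_i (weight i)%:Z * z i.

Definition setweight A : nat := (\sum_(i in A) weight i)%N.

Lemma setweight_inj : injective setweight.
Proof.
move=> A B.
have E (C : {set 'I_n}) : setweight C =
    (#|C| * m.+1 * 2 ^ n + \sum_(i < n) (i \in C) * 2 ^ i)%N.
  rewrite /setweight /weight big_split /= sum_nat_const mulnA; congr (_ + _)%N.
  by rewrite big_mkcond; apply: eq_bigr => i _; case: (i \in C); rewrite ?mul1n.
have lt (C : {set 'I_n}) : (\sum_(i < n) (i \in C) * 2 ^ i < 2 ^ n)%N.
  rewrite (@leq_ltn_trans (\sum_(i < n) 2 ^ i)%N) //; last first.
    by rewrite sum_expn2; have := expn_gt0 2 n; lia.
  by apply: leq_sum => i _; case: (i \in C); rewrite ?mul1n.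
(* Modulo [2 ^ n] there remains the number whose binary digits are the indicator of the set. *)
rewrite !E => /(congr1 (modn^~ (2 ^ n)%N)); rewrite !modnMDl !modn_small //.
pose c (C : {set 'I_n}) k := if insub k is Some i then i \in C else false.
have cE (C : {set 'I_n}) : (\sum_(i < n) (i \in C) * 2 ^ i = \sum_(i < n) c C i * 2 ^ i)%N.
  by apply: eq_bigr => i _; rewrite /c valK.
rewrite !cE => /binary_inj h; apply/setP => i.
by have := h i (ltn_ord i); rewrite /c valK.
Qed.

Lemma lin_sgset A : lin (sgset A) = (setweight A)%:Z - (setweight (~: A))%:Z.
Proof.
rewrite /lin /setweight !(big_morph Posz PoszD (erefl _)).
rewrite (bigID (mem A)) /= -sumrN; congr (_ + _).
  by apply: eq_bigr => i iA; rewrite /sgset iA mulr1.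
rewrite big_mkcond [RHS]big_mkcond /=; apply: eq_bigr => i _.
by rewrite inE /sgset; case: (i \in A) => //=; rewrite mulrN1.
Qed.

Lemma setweightC A : (setweight A + setweight (~: A) = setweight [set: 'I_n])%N.
Proof.
rewrite /setweight [RHS](bigID (mem A)) /=; congr (_ + _)%N.
  by apply: eq_bigl => i; rewrite inE.
by apply: eq_bigl => i; rewrite !inE.
Qed.

Lemma lin_sgset_inj A B : lin (sgset A) = lin (sgset B) -> A = B.
Proof.
rewrite !lin_sgset; have := setweightC A; have := setweightC B => hA hB h.
by apply: setweight_inj; lia.
Qed.

Lemma linDM (a : int) y z : lin (fun i => y i + a * z i) = lin y + a * lin z.
Proof.
rewrite /lin mulr_sumr -big_split /=; apply: eq_bigr => i _; ring.
Qed.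

Lemma lin_le z : W z -> lin z <= (setweight [set: 'I_n])%:Z * m%:Z.
Proof.
move=> Wz; rewrite /setweight (big_morph Posz PoszD (erefl _)) mulr_suml.
rewrite [X in _ <= X](eq_bigl predT) => [|i]; last by rewrite inE.
by apply: ler_sum => i _; apply: ler_wpM2l; [lia | apply: W_le].
Qed.

Definition maximal i (t : nat) z :=
  W z /\ forall y, W y -> lin y + t%:Z * y i <= lin z + t%:Z * z i.

Lemma maximal_exists i t : exists z, maximal i t z.
Proof.
have [|z Wz hz] := @int_max_exists _ W (fun z => lin z + t%:Z * z i)
  ((setweight [set: 'I_n])%:Z * m%:Z + t%:Z * m%:Z) _ W0; last by exists z.
move=> z Wz; apply: lerD; first exact: lin_le.
by apply: ler_wpM2l; [lia | apply: W_le].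
Qed.

(** The time at which [A] becomes orthogonal is [- lin (sgset A)]. Time [t] itself is excluded,
    since a maximal position at that time may still lack the gain. *)
Definition crossed i (t : nat) : nat :=
  #|[set A : {set 'I_n} | (i \in A) && (- t%:Z < lin (sgset A) < 0)]|.

(* At each time t = - lin (sgset A) both neighbours y + A and y - A of a
   maximal y have the same value as y, so the maximal positions spread over
   two values of the i-th coordinate. *)
Lemma maximal_crossed i z0 t z : maximal i 0 z0 -> (0 < t)%N ->
  maximal i t z -> z0 i + (crossed i t)%:Z <= z i.
Proof.
move=> [Wz0 max0]; case: t => [|t] // _.
(* Adding the two optimality conditions cancels [lin] and leaves the comparison of the i-th
   coordinates. *)
have mono t1 y1 y2 : maximal i t1 y1 -> maximal i t1.+1 y2 -> y1 i <= y2 i.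
  by move=> [Wy1 h1] [Wy2 h2]; have := h1 _ Wy2; have := h2 _ Wy1; lia.
elim: t z => [|t IH] z mz.
  have -> : crossed i 1 = 0%N.
    by apply/eqP; rewrite cards_eq0; apply/eqP/setP => A; rewrite !inE; lia.
  by rewrite addr0; apply: mono mz.
have [y my hy] : exists2 y, maximal i t.+1 y &
    z0 i + (crossed i t.+2)%:Z <= y i.
  have [y my] := maximal_exists i t.+1; have [Wy hy] := my.
  have [/existsP[A /andP[iA /eqP LA]]|/existsPn noA] := boolP
      [exists A : {set 'I_n}, (i \in A) && (lin (sgset A) == - (t.+1)%:Z)].
    (* Distinct sets have distinct values of [lin], so at most one crosses at this time. *)
    have cr : (crossed i t.+2 <= (crossed i t.+1).+1)%N.
      rewrite /crossed -add1n.
      set S := [set B : {set 'I_n} | _] ; set S' := [set B : {set 'I_n} | _].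
      have sub : S \subset A |: S'.
        apply/fintype.subsetP => B; rewrite !inE => /andP[iB hB]; rewrite iB /=.
        have [/lin_sgset_inj -> //|ne] := eqVneq (lin (sgset B)) (lin (sgset A)).
          by rewrite eqxx.
        by apply/orP; right; move: ne; rewrite LA; lia.
      rewrite (leq_trans (subset_leq_card sub)) // cardsU1.
      by case: (A \notin S').
    have shift (a : int) : a = 1 \/ a = -1 ->
        W (fun j => y j + a * sgset A j) ->
        maximal i t.+1 (fun j => y j + a * sgset A j).
      move=> ha Wy'; split=> // x Wx; rewrite linDM LA /sgset iA.
      by have := hy _ Wx; lia.
    (* A step up gains one over [y]. After a step down the lower position is maximal too, and the
       induction hypothesis for it leaves [y] one to spare. *)
    have [Wp|Wm] := W_step A Wy.
      have E : (fun j => y j + sgset A j) = (fun j => y j + 1 * sgset A j).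
        by apply/funext => j; rewrite mul1r.
      rewrite E in Wp; have mp := shift 1 (or_introl erefl) Wp.
      exists (fun j => y j + 1 * sgset A j) => //.
      by have := IH _ my; rewrite /sgset iA; lia.
    have E : (fun j => y j - sgset A j) = (fun j => y j + (-1) * sgset A j).
      by apply/funext => j; rewrite mulN1r.
    rewrite E in Wm; have mm := shift (-1) (or_intror erefl) Wm.
    exists y => //; have := IH _ mm; rewrite /sgset iA; lia.
  exists y => //; apply: le_trans (IH _ my); rewrite lerD2l lez_nat.
  apply: subset_leq_card; apply/fintype.subsetP => A; rewrite !inE.
  by move=> /andP[iA hA]; rewrite iA /=; have := noA A; rewrite iA /=; lia.
exact: le_trans hy (mono _ _ _ my mz).
Qed.

Definition negset := [set A : {set 'I_n} | lin (sgset A) < 0].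

Lemma negset_selector : selector negset.
Proof.
apply/forallP => A; rewrite !inE.
have E : lin (sgset (~: A)) = - lin (sgset A).
  by rewrite !lin_sgset finset.setCK opprB.
have : lin (sgset (~: A)) != lin (sgset A).
  by apply/eqP => /lin_sgset_inj/eqP; rewrite (negbTE (setC_neq _ _)).
by rewrite E; case: ltgtP; lia.
Qed.

Lemma crossed_all i : crossed i (setweight [set: 'I_n]).+1 = degree negset i.
Proof.
apply: eq_card => A; rewrite !inE andbC; congr (_ && _).
by rewrite lin_sgset; have := setweightC A; lia.
Qed.

Lemma pusher_bound : (gap n <= m.*2)%N.
Proof.
have [z0 m0] := maximal_exists (Ordinal n_gt0) 0.
(* At time 0 the functional is [lin] for every [i], so one [z0] serves all coordinates. *)
have {}m0 i : maximal i 0 z0.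
  by case: m0 => Wz0 h; split=> // y /h; rewrite !mul0r.
have [Wz0 h0] := m0 (Ordinal n_gt0).
(* A negative sum would lower [lin z0] by at least [m.+1 * 2 ^ n], while the perturbation restores
   at most [(2 ^ n - 1) * m]; but [lin z0] is at least [lin 0 = 0]. *)
have sum_ge0 : 0 <= \sum_i z0 i.
  have : 0 <= lin z0.
    have := h0 _ W0; rewrite !mul0r !addr0; apply: le_trans.
    by rewrite /lin big1 // => i _; rewrite mulr0.
  have -> : lin z0 = (m.+1 * 2 ^ n)%:Z * \sum_i z0 i + \sum_(i < n) (2 ^ i)%:Z * z0 i.
    by rewrite mulr_sumr -big_split /=; apply: eq_bigr => i _; rewrite -mulrDl -PoszD.
  have : \sum_(i < n) (2 ^ i)%:Z * z0 i <= (2 ^ n - 1)%:Z * m%:Z.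
    rewrite -sum_expn2 (big_morph Posz PoszD (erefl _)) mulr_suml.
    by apply: ler_sum => i _; apply: ler_wpM2l; [lia | apply: W_le].
  have := expn_gt0 2 n; move: (2 ^ n)%N (\sum_i z0 i) => p s p0.
  move: (\sum_(_ < n) _) => q hq h; nia.
have hi i : z0 i + (degree negset i)%:Z <= m%:Z.
  have [z mz] := maximal_exists i (setweight [set: 'I_n]).+1.
  have := maximal_crossed (m0 i) (ltn0Sn _) mz; rewrite crossed_all => /le_trans.
  by apply; apply: W_le; case: mz.
have : \sum_i (z0 i + (degree negset i)%:Z) <= \sum_(i < n) m%:Z.
  by apply: ler_sum => i _; apply: hi.
rewrite big_split /= sumr_const card_ord -(big_morph Posz PoszD (erefl _)).
rewrite sum_degree => hsum.
have hmin : (\sum_(A in negset) minn #|A| (n - #|A|) <= \sum_(A in negset) #|A|)%N.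
  by apply: leq_sum => A _; rewrite geq_minl.
have := sum_selector_min n_gt0 negset_selector => hgap.
have : (n * gap n <= n * m.*2)%N.
  rewrite -hgap; move: hmin hsum sum_ge0; rewrite -mulr_natl natz.
  move: (\sum_(A in negset) #|A|)%N (\sum_(A in negset) minn _ _)%N (\sum_i z0 i).
  by move=> a b c; lia.
by rewrite leq_pmul2l.
Qed.

End Pusher.

(** * Strategies *)

Section Game.
Variables (R : realType) (n : nat).
Implicit Types (A : {set 'I_n}) (F : {set {set 'I_n}}) (M : R).

Definition vec A : 'rV[R]_n := \row_i (sgset A i)%:~R.

Lemma vec_Vpm A i0 : val i0 = 0%N -> i0 \in A -> Vpm (vec A).
Proof.
move=> i00 i0A; split=> [i|i iv]; rewrite mxE /sgset; first by case: ifP; [left|right].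
by rewrite (_ : i = i0) ?i0A //; apply: val_inj; rewrite iv i00.
Qed.

Lemma positionS (s : chooser_strategy R n) v k : position s v k.+1 =
  position s v k + sgn_of R (s (mkseq v k.+1)) *: v k.
Proof. by rewrite /position big_ord_recr. Qed.

Lemma eq_position (s : chooser_strategy R n) v w k :
  (forall j, (j < k)%N -> v j = w j) -> position s v k = position s w k.
Proof.
move=> vw; apply: eq_bigr => j _; rewrite vw //; congr (sgn_of _ (s _) *: _).
by apply/eq_in_map => x; rewrite mem_iota /= => xj; apply: vw; have := ltn_ord j; lia.
Qed.

Lemma chooser_wins_gap M : (0 < n)%N ->
  chooser_wins (@Vpm R n) (@KM R n M) ->
  exists2 m : nat, m%:R <= M & (gap n <= m.*2)%N.
Proof.
move=> n0 [s sP]; pose o := Ordinal n0.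
have Vo : Vpm (vec [set: 'I_n]) by apply: (vec_Vpm (i0 := o)); rewrite ?inE.
have M0 : 0 <= M.
  have := sP (fun=> vec [set: 'I_n]) (fun=> Vo) 0%N o.
  by rewrite /position big_ord0 mxE.
have fl : (absz (Num.floor M))%:Z = Num.floor M.
  by rewrite gez0_abs // floor_ge0.
(* Reachable positions are integral, so [M] may be rounded down. *)
exists (absz (Num.floor M)); first by rewrite pmulrn fl floor_le.
pose W (z : 'I_n -> int) := exists v k, (forall j, Vpm (v j)) /\
  forall i, position s v k 0 i = (z i)%:~R.
apply: (@pusher_bound n W) => //.
- exists (fun=> vec [set: 'I_n]), 0%N; split=> // i.
  by rewrite /position big_ord0 mxE.
- move=> z A [v [k [Vv pos]]].
  have [B [oB BA]] : exists B : {set 'I_n}, o \in B /\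
      ((forall i, sgset B i = sgset A i) \/ (forall i, sgset B i = - sgset A i)).
    have [oA|oA] := boolP (o \in A); first by exists A; split=> //; left.
    exists (~: A); rewrite inE oA; split=> //; right=> i.
    by rewrite /sgset inE; case: (i \in A).
  (* The strategy sees only past and current offers, so changing the offers from round [k] on keeps
     the position reached. *)
  pose w j := if (j < k)%N then v j else vec B.
  have Vw j : Vpm (w j) by rewrite /w; case: ifP => // _; apply: (vec_Vpm (i0 := o)).
  have posw i : position s w k.+1 0 i =
      (z i)%:~R + sgn_of R (s (mkseq w k.+1)) * (sgset B i)%:~R.
    rewrite positionS (@eq_position s w v) => [|j jk]; last by rewrite /w jk.
    by rewrite !mxE pos /w ltnn !mxE.
  move: posw; case: (s _) => posw; case: BA => BA.
  + left; exists w, k.+1; split=> // i.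
    by rewrite posw BA /sgn_of mul1r -intrD.
  + right; exists w, k.+1; split=> // i.
    by rewrite posw BA /sgn_of mul1r -intrD.
  + right; exists w, k.+1; split=> // i.
    by rewrite posw BA /sgn_of mulN1r -intrN -intrD.
  + left; exists w, k.+1; split=> // i.
    by rewrite posw BA /sgn_of mulN1r -intrN -intrD opprK.
- move=> z i [v [k [Vv pos]]]; rewrite fl floor_ge_int -pos.
  exact: sP.
Qed.

(** * Chooser's alternating strategy *)

Definition support (v : 'rV[R]_n) : {set 'I_n} := [set i | v 0 i == 1].

Definition member F (v : 'rV[R]_n) :=
  if support v \in F then support v else ~: support v.

(** The history includes the current offer, so the count is odd at the first, third, ... offer of a
    pair, and the sign then adds the selected set. *)
Definition alternating F : chooser_strategy R n := fun h =>
  let v := last 0 h in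
  (support v \in F) == odd (count (fun u => member F u == member F v) h).

Lemma Vpm_sgset F (v : 'rV[R]_n) i : Vpm v ->
  v 0 i = sgn_of R (support v \in F) * (sgset (member F v) i)%:~R.
Proof.
move=> [/(_ i) vi _]; rewrite /member /sgset.
have m1 : (-1 == 1 :> R) = false by apply/eqP => h; lra.
by case: (support v \in F); rewrite /sgn_of ?inE; case: vi => ->;
  rewrite ?eqxx ?m1 /=; lra.
Qed.

(** Successive offers of the same pair cancel two by two. *)
Lemma position_alternating F v k i : selector F -> (forall j, Vpm (v j)) ->
  position (alternating F) v k 0 i = \sum_(A in F)
    (odd (count (fun u => member F u == A) (mkseq v k)))%:R * (sgset A i)%:~R.
Proof.
move=> sF Vv; elim: k => [|k IH].
  by rewrite /position big_ord0 mxE big1 // => A _; rewrite mul0r.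
have mF : member F (v k) \in F.
  by rewrite /member; case: ifPn => // h; rewrite selectorC.
rewrite positionS !mxE IH mkseqS (bigD1 (member F (v k))) //=.
rewrite [RHS](bigD1 (member F (v k))) //= addrAC; congr (_ + _); last first.
  apply: eq_bigr => A /andP[_ Ak]; rewrite -cats1 count_cat /=.
  by rewrite eq_sym (negbTE Ak) !addn0.
rewrite (@Vpm_sgset F (v k)) // /alternating last_rcons -cats1 count_cat /=.
rewrite eqxx addn0 addn1 /=.
by case: (support _ \in F); case: (odd _); rewrite /sgn_of /=; lra.
Qed.

Lemma chooser_wins_degree F M : selector F ->
  (forall i, (degree F i)%:R <= M) -> chooser_wins (@Vpm R n) (@KM R n M).
Proof.
move=> sF dM; exists (alternating F) => v Vv k i.
rewrite position_alternating //; apply: le_trans (dM i).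
rewrite degreeE natr_sum; apply: ler_sum => A _.
by rewrite /sgset; case: (odd _); case: (i \in A) => /=; lra.
Qed.

Lemma chooser_winsP M : (1 < n)%N ->
  chooser_wins (@Vpm R n) (@KM R n M) <-> (uphalf (gap n))%:R <= M.
Proof.
move=> n1; split=> [/chooser_wins_gap[|m mM gm]|hM]; first by lia.
  by apply: le_trans mM; rewrite ler_nat; lia.
have [F [sF dF]] := balanced_selector_exists n1.
by apply: (chooser_wins_degree sF) => i; apply: le_trans hM; rewrite ler_nat.
Qed.

End Game.

(** * Closed form and asymptotics of the critical value *)

(** Rounding up adds one half exactly when [gap n] is odd; as [2 ^ n.-1] is even, this is the parity
    of the binomial coefficient. *)
Lemma uphalf_gap (R : realType) n : (1 < n)%N -> (uphalf (gap n))%:R =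
  2 ^+ (n - 2) - ('C(n.-1, n./2))%:R / 2 + (odd 'C(n.-1, n./2))%:R / 2 :> R.
Proof.
move=> n1.
have h : ('C(n.-1, n./2) <= 2 ^ n.-1)%N.
  rewrite -(@leq_exp2r _ _ 2) // -expnM mulnC expnM.
  by apply: leq_trans (sqr_bin_half (ltnW n1)); apply: leq_pmull; lia.
have e : (2 ^ n.-1 = 2 * 2 ^ (n - 2))%N by rewrite -expnS; congr (2 ^ _)%N; lia.
have : (2 * uphalf (gap n) + 'C(n.-1, n./2) =
   2 * 2 ^ (n - 2) + odd 'C(n.-1, n./2))%N by rewrite /gap; lia.
move=> /(congr1 (fun x : nat => x%:R : R)).
rewrite natrD natrM natrD natrM natrX; lra.
Qed.

Lemma crit_valE (R : realType) n : (1 < n)%N ->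
  crit_val R n = (uphalf (gap n))%:R.
Proof.
move=> n1; rewrite uphalf_gap // /crit_val.
have [on|en] := boolP (odd n).
  have E : n./2 = n.-1./2 by lia.
  have : ~ is_pow2 n by case=> -[|k] nk; [lia | rewrite expnS in nk; lia].
  move/(odd_bin_half n1)/negP/negbTE => ->; rewrite E /=; lra.
have [p2|np2] := asboolP (is_pow2 n); first by rewrite (iffRL (odd_bin_half n1) p2).
have /negP/negbTE -> : ~ odd 'C(n.-1, n./2) by move/(odd_bin_half n1).
by rewrite /=; lra.
Qed.

(** The relative error is at most ['C(n.-1, n./2)] divided by [2 ^ n.-1], which [sqr_bin_half]
    bounds with constant 1. *)
Lemma crit_val_asymptotic (R : realType) n : (1 < n)%N ->
  `| crit_val R n / 2 ^+ (n - 2) - 1 | <= 1 / Num.sqrt (n%:R).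
Proof.
move=> n1; rewrite crit_valE // uphalf_gap //.
have p : (0 : R) < 2 ^+ (n - 2) by rewrite exprn_gt0.
have sn : (0 : R) < Num.sqrt n%:R by rewrite sqrtr_gt0 ltr0n; lia.
set c := 'C(n.-1, n./2).
have oc : ((odd c)%:R <= c%:R :> R) by rewrite ler_nat; case: (c) => // x; case: (odd _).
have oc0 : (0 <= (odd c)%:R :> R) by [].
have -> : (2 ^+ (n - 2) - c%:R / 2 + (odd c)%:R / 2) / 2 ^+ (n - 2) - 1 =
   - ((c%:R - (odd c)%:R) / 2 / 2 ^+ (n - 2)) :> R by field; lra.
rewrite normrN ger0_norm; last by apply: divr_ge0; [lra | exact: ltW].
rewrite ler_pdivlMr // mulrAC ler_pdivrMr // mul1r.
apply: (@le_trans _ _ (c%:R / 2 * Num.sqrt n%:R)).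
  by apply: ler_wpM2r; [exact: ltW | lra].
suff : c%:R * Num.sqrt n%:R <= 2 * 2 ^+ (n - 2) :> R by lra.
rewrite -ler_sqr ?nnegrE; [|by apply: mulr_ge0 => //; exact: ltW|by apply: mulr_ge0 => //; exact: ltW].
rewrite exprMn sqr_sqrtr // -exprS -exprM -natrX -natrM -natrX ler_nat.
have -> : (2 ^ ((n - 2).+1 * 2) = 4 ^ n.-1)%N.
  by rewrite mulnC expnM; congr (_ ^ _)%N; lia.
by rewrite mulnC; apply: sqr_bin_half; lia.
Qed.

Theorem theorem1p4 :
  (forall (R : realType) (n : nat) (M : R), (1 < n)%N ->
     (odd n ->
        (chooser_wins (@Vpm R n) (@KM R n M) <->
         2 ^+ (n - 2) - ('C(n.-1, n.-1./2))%:R / 2 <= M)) /\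
     (~~ odd n -> ~ is_pow2 n ->
        (chooser_wins (@Vpm R n) (@KM R n M) <->
         2 ^+ (n - 2) - ('C(n.-1, n./2))%:R / 2 <= M)) /\
     (is_pow2 n ->
        (chooser_wins (@Vpm R n) (@KM R n M) <->
         2 ^+ (n - 2) - ('C(n.-1, n./2))%:R / 2 + 1 / 2 <= M))) /\
  (* the critical value is 2^(n-2) (1 - O(n^(-1/2))) *)
  (forall R : realType, exists C : R, 0 < C /\
     forall n : nat, (1 < n)%N ->
       `| crit_val R n / 2 ^+ (n - 2) - 1 | <= C / Num.sqrt (n%:R)).
Proof.
split=> [R n M n1|R]; last first.
  by exists 1; split=> // n; apply: crit_val_asymptotic.
have even_pow2 : is_pow2 n -> ~~ odd n.
  by case=> -[|k] nk; [lia | rewrite expnS in nk; lia].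
have game := chooser_winsP M n1; rewrite -crit_valE // in game.
split; last split.
- by move=> on; rewrite game /crit_val on.
- by move=> en np2; rewrite game /crit_val (negbTE en) asboolF.
- by move=> p2; rewrite game /crit_val (negbTE (even_pow2 p2)) asboolT.
Qed.
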